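(* Let $L$, $D$, $A_j$, $b_j$, $p_j$, $E(L)$, $M_2L$, $M_2D$ and $\operatorname{Var}_xL$ be as in the context. Then for every $x\in I$: $$0\le M_2L(x)-\operatorname{Var}_xL\le M_2D(x),$$ $$M_2L(x)=E(L)(x)+M_2D(x),$$ $$E(L)(x)\le \operatorname{Var}_xL .$$
   Context: Let $I\subset\mathbb{R}$ be an interval, $e_i(t)=t^i$, and let $H$ be a linear subspace of $C(I)$ containing $e_0,e_1,e_2$. Let $p_j\in C(I)$ ($j\ge 0$) with $p_j\ge 0$ and $\sum_{j=0}^\infty p_j=e_0$ pointwise on $I$. Let $A_j:H\to\mathbb{R}$ ($j\ge 0$) be positive linear functionals (that is, $A_j(f)\ge 0$ whenever $f\in H$, $f\ge 0$ on $I$) with $A_j(e_0)=1$. Assume that $Lf:=\sum_{j=0}^\infty A_j(f)\,p_j$ defines a positive linear operator $L:H\to C(I)$ (the series converging pointwise on $I$ for every $f\in H$). Put $b_j:=A_j(e_1)$ and $\operatorname{Var}A_j:=A_j(e_2)-b_j^2$. It is assumed that $b_j\in I$ for all $j$ and that the discrete operator associated with $L$, $Df:=\sum_{j=0}^\infty f(b_j)\,p_j$, is well defined as an operator $D:H\to C(I)$. For an operator $T\in\{L,D\}$ the second moment is $M_2T(x):=\bigl(T(e_1-xe_0)^2\bigr)(x)$, i.e. $T$ applied to $t\mapsto (t-x)^2$ and evaluated at $x$. Further, $\operatorname{Var}_xL:=Le_2(x)-(Le_1(x))^2$ and $E(L)(x):=\sum_{j=0}^\infty(\operatorname{Var}A_j)\,p_j(x)$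 for $x\in I$. *)

(* Defs.v *)
From HB Require Import structures.
From mathcomp Require Import all_boot all_order all_algebra.
From mathcomp Require Import all_classical all_reals all_analysis.

Set Implicit Arguments.
Unset Strict Implicit.
Unset Printing Implicit Defensive.

Import Order.TTheory GRing.Theory Num.Theory.
Import numFieldNormedType.Exports.

Local Open Scope classical_set_scope.
Local Open Scope ring_scope.

(* Functions on I have type I -> R^o, with I : set R coerced to the subtype
   {x : R | x \in I} carrying the subspace topology. R^o is R seen as a module
   over itself, which gives I -> R^o its pointwise vector space and ring
   structures. *)

Definition C (R : realType) (I : set R) : set (I -> R^o) :=
  [set f | continuous f].

Definition e (R : realType) (I : set R) (i : nat) : I -> R^o :=
  fun t => (\val t) ^+ i.
Arguments e {R} I i.

(* A map defined on a subspace H is represented by a function on all of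
   I -> R^o of which only the values on H are ever constrained or used. *)

Definition linear_on (R : realType) (I : set R) (V : lmodType R)
    (H : set (I -> R^o)) (T : (I -> R^o) -> V) : Prop :=
  forall (a : R) (f g : I -> R^o), H f -> H g ->
    T (a *: f + g) = a *: T f + T g.

Definition positive_linear_functional (R : realType) (I : set R)
    (H : set (I -> R^o)) (A : (I -> R^o) -> R^o) : Prop :=
  linear_on H A /\
  (forall f, H f -> (forall t, 0 <= f t) -> 0 <= A f).

Definition positive_linear_operator (R : realType) (I : set R)
    (H : set (I -> R^o)) (T : (I -> R^o) -> (I -> R^o)) : Prop :=
  [/\ linear_on H T,
      forall f, H f -> C (T f)
    & forall f, H f -> (forall t, 0 <= f t) -> forall x, 0 <= T f x].

Definition series_op (R : realType) (I : set R) (F : nat -> (I -> R^o) -> R^o)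
    (p : nat -> I -> R^o) (f : I -> R^o) : I -> R^o :=
  fun x => limn (series (fun j => F j f * p j x)).

(* limn is a total function, so convergence has to be required separately. *)
Definition series_op_cvg (R : realType) (I : set R) (H : set (I -> R^o))
    (F : nat -> (I -> R^o) -> R^o) (p : nat -> I -> R^o) : Prop :=
  forall f, H f -> forall x, cvgn (series (fun j => F j f * p j x)).

Definition discrete_op (R : realType) (I : set R) (b : nat -> I)
    (p : nat -> I -> R^o) : (I -> R^o) -> (I -> R^o) :=
  series_op (fun j f => f (b j)) p.

Definition M2 (R : realType) (I : set R) (T : (I -> R^o) -> (I -> R^o))
    (x : I) : R :=
  T ((e I 1 - \val x *: e I 0) ^+ 2) x.

Definition Var_functional (R : realType) (I : set R)
    (A : (I -> R^o) -> R^o) : R :=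
  A (e I 2) - (A (e I 1)) ^+ 2.

Definition Var_at (R : realType) (I : set R)
    (T : (I -> R^o) -> (I -> R^o)) (x : I) : R :=
  T (e I 2) x - (T (e I 1) x) ^+ 2.

Definition E_op (R : realType) (I : set R) (A : nat -> (I -> R^o) -> R^o)
    (p : nat -> I -> R^o) (x : I) : R :=
  limn (series (fun j => Var_functional (A j) * p j x)).

(* Main.v *)
Require Import Defs.
From HB Require Import structures.
From mathcomp Require Import all_boot all_order all_algebra.
From mathcomp Require Import all_classical all_reals all_analysis.
From mathcomp Require Import ring lra.

(* Since L and D agree on e_0 and e_1, their second moments at x differ by
   L e_2 - D e_2, which is E(L), while M_2 L - Var L = (L e_1 - x)^2.  Both
   inequalities then amount to (D e_1)^2 <= D e_2, i.e. to Jensen's inequality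
   for the square with the weights p_j(x). *)

Set Implicit Arguments.
Unset Strict Implicit.
Unset Printing Implicit Defensive.

Import Order.TTheory GRing.Theory Num.Theory.
Import numFieldNormedType.Exports.

Local Open Scope classical_set_scope.
Local Open Scope ring_scope.

(** The partial sums are a fixed linear combination of the three given ones. [v] is kept independent
    of [u ^+ 2]: for [L] the two sequences are [A_j e_2] and [A_j e_1], whose gap is the
    variance. *)
Lemma cvg_weighted_quadratic (R : realType) (q u v : nat -> R^o) (c l m : R) :
  series q @ \oo --> (1 : R^o) ->
  series (fun j => u j * q j) @ \oo --> (l : R^o) ->
  series (fun j => v j * q j) @ \oo --> (m : R^o) ->
  series (fun j => (v j - 2 * c * u j + c ^+ 2) * q j) @ \oo -->
    (m - 2 * c * l + c ^+ 2 : R^o).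
Proof.
move=> q1 cu cv.
rewrite (_ : series _ = series (fun j => v j * q j)
   - 2 * c *: series (fun j => u j * q j) + c ^+ 2 *: series q); last first.
  apply/funext => n; rewrite !fctE /series /= /GRing.scale /= !mulr_sumr -sumrB.
  by rewrite -big_split; apply: eq_bigr => j _ /=; ring.
rewrite -[X in _ --> _ + X]mulr1.
apply: cvgD; [apply: cvgB => //|]; exact: cvgZl_tmp.
Qed.

(** With [m] the weighted mean, the difference of the two sides is the weighted variance, the sum of
    the nonnegative terms [(u j - m) ^+ 2 * q j]. *)
Lemma weighted_Jensen_sqr (R : realType) (q u : nat -> R^o) :
  (forall j, 0 <= q j) -> series q @ \oo --> (1 : R^o) ->
  cvgn (series (fun j => u j * q j)) ->
  cvgn (series (fun j => u j ^+ 2 * q j)) ->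
  limn (series (fun j => u j * q j)) ^+ 2
    <= limn (series (fun j => u j ^+ 2 * q j)).
Proof.
move=> q0 q1 cu cv; set m := limn (series (fun j => u j * q j)).
(* Writing [- m ^+ 2] as [- 2 * m * m + m ^+ 2] gives the limit of the quadratic series centred at
   [c = m]. *)
rewrite -subr_ge0 [leRHS](_ : _ =
    limn (series (fun j => u j ^+ 2 * q j)) - 2 * m * m + m ^+ 2); last by ring.
have c2 := cvg_weighted_quadratic (c := m) q1 cu cv.
rewrite -(cvg_lim _ c2) //; apply: limr_ge; first exact: cvgP c2.
apply: nearW => n; apply: sumr_ge0 => j _; rewrite mulr_ge0 //.
by rewrite [leRHS](_ : _ = (u j - m) ^+ 2) ?sqr_ge0 //; ring.
Qed.

(** The nesting has the shape [a *: f + g] twice over, so that [linear_on] applies directly. *)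
Lemma sqr_e1_sub (R : realType) (I : set R) (c : R) :
  (e I 1 - c *: e I 0) ^+ 2 = (- (2 * c)) *: e I 1 + (c ^+ 2 *: e I 0 + e I 2).
Proof.
by apply/funext => t; rewrite expr2 /e !fctE /GRing.scale /= expr0 expr1; ring.
Qed.

(** General functionals [F] cover both [L] and [D]; the square is expanded inside each [F j], then
    summed. *)
Lemma M2_series_op (R : realType) (I : set R) (H : set (I -> R^o))
    (p : nat -> I -> R^o) (F : nat -> (I -> R^o) -> R^o) (x : I) :
  submod_closed [in H] -> H (e I 0) -> H (e I 1) -> H (e I 2) ->
  series (fun j => p j x) @ \oo --> (1 : R^o) ->
  (forall j, linear_on H (F j)) -> (forall j, F j (e I 0) = 1) ->
  series_op_cvg H F p ->
  M2 (series_op F p) x = series_op F p (e I 2) x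
    - 2 * \val x * series_op F p (e I 1) x + \val x ^+ 2.
Proof.
move=> [_ Hlin] H0 H1 H2 p1 Flin F0 cF.
have HD a f g : H f -> H g -> H (a *: f + g).
  by move=> /mem_set Hf /mem_set Hg; apply/set_mem; apply: Hlin.
apply: cvg_lim => //.
rewrite [X in series X](_ : _ = fun j =>
    (F j (e I 2) - 2 * \val x * F j (e I 1) + \val x ^+ 2) * p j x).
  by apply: cvg_weighted_quadratic => //; exact: cF.
apply/funext => j; congr (_ * _).
rewrite sqr_e1_sub !Flin ?F0 //; last exact: HD.
by rewrite /GRing.scale /=; ring.
Qed.

Theorem mainTheorem2 (R : realType) (I : set R) (H : set (I -> R^o))
    (p : nat -> I -> R^o) (A : nat -> (I -> R^o) -> R^o) (b : nat -> I)
    (I_itv : is_interval I)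
    (H_C : H `<=` @C R I)
    (H_sub : submod_closed [in H])
    (H_e : H (e I 0) /\ H (e I 1) /\ H (e I 2))
    (p_C : forall j, C (p j))
    (p_ge0 : forall j x, 0 <= p j x)
    (p_sum : forall x, series (fun j => p j x) @ \oo --> e I 0 x)
    (A_pos : forall j, positive_linear_functional H (A j))
    (A_e0 : forall j, A j (e I 0) = 1)
    (L_cvg : series_op_cvg H A p)
    (L_pos : positive_linear_operator H (series_op A p))
    (bE : forall j, \val (b j) = A j (e I 1))
    (D_cvg : series_op_cvg H (fun j f => f (b j)) p)
    (D_C : forall f, H f -> C (discrete_op b p f)) :
  let L := series_op A p in
  let D := discrete_op b p in
  forall x : I,
    [/\ 0 <= M2 L x - Var_at L x <= M2 D x,
        M2 L x = E_op A p x + M2 D x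
      & E_op A p x <= Var_at L x].
Proof.
move=> L D x; case: H_e => H0 [H1 H2].
have p1 : series (fun j => p j x) @ \oo --> (1 : R^o) by exact: p_sum.
have M2L := M2_series_op H_sub H0 H1 H2 p1 (fun j => (A_pos j).1) A_e0 L_cvg.
have M2D : M2 D x = D (e I 2) x - 2 * \val x * D (e I 1) x + \val x ^+ 2.
  (* Evaluation at [b j] is linear and sends [e I 0] to 1 by computation. *)
  exact: (M2_series_op H_sub H0 H1 H2 p1).
have De1 : D (e I 1) x = L (e I 1) x.
  by rewrite /D /discrete_op /L /series_op; under eq_fun do rewrite /e expr1 bE.
have De2 : L (e I 1) x ^+ 2 <= D (e I 2) x.
  (* The values of [e I 1] and [e I 2] at the node [b j] are convertible to [u j] and [u j ^+ 2]. *)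
  rewrite -De1; apply: (weighted_Jensen_sqr (u := fun j => \val (b j))) => //.
  - exact: (D_cvg _ H1 x).
  - exact: (D_cvg _ H2 x).
have EE : E_op A p x = L (e I 2) x - D (e I 2) x.
  (* Convergence of both series allows merging the limits; termwise, [b j] being the mean of [A j]
     turns [A_j e_2 - e_2(b_j)] into the variance. *)
  rewrite -limB; [|exact: L_cvg|exact: D_cvg].
  congr (limn _); apply/funext => n; rewrite fctE /series /= -sumrB.
  by apply: eq_bigr => j _; rewrite /Var_functional -bE /e; ring.
rewrite EE M2D De1 M2L /Var_at -/L.
split; [apply/andP; split| |].
- rewrite [leRHS](_ : _ = (L (e I 1) x - \val x) ^+ 2) ?sqr_ge0 //; ring.
- by lra.
- by ring.
- by lra.
Qed.
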